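(* There exist collections $\mathcal C_1$ and $\mathcal C_2$ of languages over the universe $\mathbb Z$ such that $\mathcal C_1$ is non-uniformly generatable without samples (equivalently, generatable in the limit without samples), $\mathcal C_2$ is uniformly generatable without samples, but $\mathcal C_1 \cup \mathcal C_2$ is not generatable in the limit.
   Context: A language is an infinite subset of a countably infinite universe $U$ (here $U=\mathbb Z$); a collection is a (possibly uncountable) set of languages. An enumeration of a language $K$ is an infinite sequence $x_0, x_1, \dots$ of pairwise distinct elements of $K$ such that every element of $K$ appears in it; $S_t=\{x_0,\dots,x_t\}$. A generator algorithm is an arbitrary function $G$ from finite sequences of elements of $U$ to $U$; its output at time $t$ is $z_t=G(x_0,\dots,x_t)$. $G$ generates in the limit for $\mathcal C$ if for every $K\in\mathcal C$ and every enumeration $x$ of $K$ there is $t^\star$ such that $z_t\in K\setminus S_t$ for all $t\ge t^\star$; $\mathcal C$ is generatable in the limit if such a $G$ exists. A generator without samples is an injection $G:\mathbb N\to U$ (output $z_t=G(t)$). It uniformly generates without samples for $\mathcal C$ if there is $t^\star$ such that $z_t\in K$ for every $K\in\mathcal C$ and every $t\ge t^\star$; it generates in the limit without samples (equivalently, non-uniformly generates without samples) for $\mathcal C$ if for every $K\in\mathcal C$ there is $t^\star$ with $z_t\in K$ for all $t\ge t^\star$. *)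

(* Defs.v *)
From mathcomp Require Import all_boot all_order all_algebra.
From mathcomp Require Import boolp classical_sets functions cardinality.

Set Implicit Arguments.
Unset Strict Implicit.
Unset Printing Implicit Defensive.

Local Open Scope classical_set_scope.

Section Generation.
Variable U : Type.
Implicit Types (K : set U) (C : set (set U)) (x : nat -> U).

Definition is_language K : Prop := infinite_set K.

Definition is_collection C : Prop := forall K, C K -> is_language K.

Definition enumeration x K : Prop := injective x /\ range x = K.

Definition sample x (t : nat) : set U := [set x i | i in [set i | (i <= t)%N]].

Definition output (G : seq U -> U) x (t : nat) : U := G (mkseq x t.+1).

Definition generates_in_limit (G : seq U -> U) C : Prop :=
  forall K, C K -> forall x, enumeration x K ->
    exists tstar : nat, forall t : nat, (tstar <= t)%N ->
      (K `\` sample x t) (output G x t).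

Definition generatable_in_limit C : Prop :=
  exists G : seq U -> U, generates_in_limit G C.

Definition uniformly_generates_without_samples (G : nat -> U) C : Prop :=
  exists tstar : nat, forall K, C K ->
    forall t : nat, (tstar <= t)%N -> K (G t).

Definition uniformly_generatable_without_samples C : Prop :=
  exists G : nat -> U, injective G /\ uniformly_generates_without_samples G C.

(* Also called generation in the limit without samples: the threshold may
   depend on the language, and there is no enumeration for it to depend on. *)
Definition nonuniformly_generates_without_samples (G : nat -> U) C : Prop :=
  forall K, C K ->
    exists tstar : nat, forall t : nat, (tstar <= t)%N -> K (G t).

Definition nonuniformly_generatable_without_samples C : Prop :=
  exists G : nat -> U,
    injective G /\ nonuniformly_generates_without_samples G C.

End Generation.

(* Main.v *)
(* Take for C1 the sets containing all large nonnegative integers and for C2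
   the sets containing all negative integers.  Given a generator G, extend a
   finite sequence s by consecutive large integers n, n+1, ...: continued
   forever, this enumerates a member of C1, so at some time G answers with an
   integer m not shown so far.  Stop there, forbid m by showing only larger
   nonnegative integers later on, show the next negative integer, and repeat.
   The limit enumerates a member of C2, and G errs at every stage. *)
Require Import Defs.
From mathcomp Require Import all_boot all_order all_algebra.
From mathcomp Require Import boolp classical_sets functions cardinality.
From mathcomp Require Import zify.

Local Open Scope classical_set_scope.

Lemma infinite_set_inj_sub (T : Type) (f : nat -> T) (K : set T) (n : nat) :
  injective f -> (forall m, (n <= m)%N -> K (f m)) -> infinite_set K.
Proof.
move=> f_inj fK K_fin; apply: infinite_nat.
have <- : (fun m => f (n + m)%N) @^-1` K = setT.
  by apply/seteqP; split=> // m _; apply: fK; rewrite leq_addr.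
by apply: finite_preimage => // i j _ _ /f_inj/addnI.
Qed.

Definition cofinitely_nonneg : set (set int) :=
  [set K | exists n, forall m, (n <= m)%N -> K (Posz m)].

Definition all_neg : set (set int) := [set K | forall m, K (Negz m)].

Definition continuation (s : seq int) (n i : nat) : int :=
  if (i < size s)%N then nth 0%R s i else Posz (n + (i - size s)).

(* A stage [(s, n)] is the sequence shown so far and a bound below which no
   further nonnegative integer may be shown; [k] negative integers are in [s]. *)
Definition stage_invariant (k : nat) (st : seq int * nat) : Prop :=
  [/\ uniq st.1, forall m, Posz m \in st.1 -> (m < st.2)%N &
      forall m, (Negz m \in st.1) = (m < k)%N].

(** The third clause makes an error permanent: the answer [m] of [G] is absent from the new sequence
    and below the new bound, so no later stage can show it. The input [take t.+1 st'.1] is what [G]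
    sees at time [t]. *)
Definition fools (G : seq int -> int) (st st' : seq int * nat) : Prop :=
  [/\ prefix st.1 st'.1, (st.2 <= st'.2)%N,
      forall m, (m < st.2)%N -> Posz m \in st'.1 -> Posz m \in st.1 &
      exists t m, [/\ (size st.1 <= t < size st'.1)%N, (m < st'.2)%N,
        Posz m \notin st'.1 & G (take t.+1 st'.1) = Posz m]].

Lemma mem_continuation (s : seq int) (n t : nat) (z : int) :
  (size s <= t)%N ->
  reflect (z \in s \/ exists2 m, (n <= m < n + (t - size s))%N & z = Posz m)
    (z \in mkseq (continuation s n) t).
Proof.
move=> st; apply: (iffP mapP) => [[i]|].
  rewrite mem_iota /continuation => it ->; case: ltnP => i_s.
    by left; apply: mem_nth.
  by right; exists (n + (i - size s))%N => //; lia.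
case=> [zs|[m mn ->]].
  exists (index z s).
    by rewrite mem_iota /= add0n (leq_trans _ st) ?index_mem.
  by rewrite /continuation index_mem zs nth_index.
exists (size s + (m - n))%N; first by rewrite mem_iota; lia.
by rewrite /continuation ifF; [congr Posz|]; lia.
Qed.

Lemma continuation_inj (s : seq int) (n : nat) :
  uniq s -> (forall m, Posz m \in s -> (m < n)%N) ->
  injective (continuation s n).
Proof.
move=> s_uniq s_lt i j; rewrite /continuation.
case: ltnP => i_s; case: ltnP => j_s.
- by move/eqP; rewrite nth_uniq // => /eqP.
- by move=> e; have := mem_nth 0%R i_s; rewrite e => /s_lt; lia.
- by move=> e; have := mem_nth 0%R j_s; rewrite -e => /s_lt; lia.
- by case; lia.
Qed.

Lemma take_continuation (s : seq int) (n t : nat) :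
  (size s <= t)%N -> take (size s) (mkseq (continuation s n) t) = s.
Proof.
move=> st.
have size_s : size (take (size s) (mkseq (continuation s n) t)) = size s.
  by rewrite size_takel ?size_mkseq.
apply: (@eq_from_nth _ 0%R) => // i; rewrite size_s => i_s.
by rewrite nth_take // nth_mkseq ?(leq_trans i_s) // /continuation i_s.
Qed.

(** Being injective, the continuation enumerates its own range, which lies in [cofinitely_nonneg];
    thus [G] must eventually answer with one of its terms not yet shown. *)
Lemma fooling_step (G : seq int -> int) (k : nat) (st : seq int * nat) :
  generates_in_limit G cofinitely_nonneg -> stage_invariant k st ->
  exists st', stage_invariant k.+1 st' /\ fools G st st'.
Proof.
case: st => s n G_gen [/= s_uniq s_pos s_neg].
set x := continuation s n.
have x_inj : injective x by apply: continuation_inj.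
(* Waiting until time [size s] at least keeps all of [s] in the cut sequence and forces the unseen
   answer into the consecutive tail. *)
have [|tstar /(_ (maxn tstar (size s)) (leq_maxl _ _))] :=
  G_gen (range x) _ x (conj x_inj erefl).
  exists n => m nm; exists (size s + (m - n))%N => //.
  by rewrite /x /continuation ifF; [congr Posz|]; lia.
set t := maxn _ _ => -[[i _]]; rewrite /output => Gx Gnew.
have st : (size s <= t)%N by rewrite leq_maxr.
have ti : (t < i)%N.
  by rewrite ltnNge; apply/negP => it; apply: Gnew; exists i.
have xi : x i = Posz (n + (i - size s)) by rewrite /x /continuation ifF //; lia.
set s' := mkseq x t.+1 in Gx *.
have size_s' : size s' = t.+1 by rewrite size_mkseq.
have s'_uniq : uniq s' by rewrite mkseq_uniq.
have s'_take : take (size s) s' = s by rewrite take_continuation ?leqW.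
have s'P z := mem_continuation s n t.+1 z (leqW st).
rewrite -/x -/s' in s'P; clearbody s'.
(* The new bound is one above the answer; as [t < i], it also exceeds every nonnegative integer
   shown so far. *)
exists (rcons s' (Negz k), (n + (i - size s)).+1); split; split => /=.
- rewrite rcons_uniq s'_uniq andbT.
  by apply/s'P => -[|[]//]; rewrite s_neg ltnn.
- move=> m; rewrite mem_rcons inE /= => /s'P[/s_pos|[m' + [->]]]; lia.
- move=> m; rewrite mem_rcons inE; apply/orP/idP => [[/eqP[->]//|/s'P[|[]//]]|].
    by rewrite s_neg; lia.
  rewrite ltnS leq_eqVlt => /orP[/eqP->|mk]; first by left.
  by right; apply/s'P; left; rewrite s_neg.
- by rewrite prefixE -cats1 takel_cat ?size_s' ?leqW // s'_take.
- by lia.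
- by move=> m mn; rewrite mem_rcons inE /= => /s'P[//|[m' + [?]]]; lia.
- exists t, (n + (i - size s))%N; split => //.
  + by rewrite size_rcons size_s' st leqW.
  + by rewrite mem_rcons inE /=; apply/s'P => -[/s_pos|[m' + [?]]]; lia.
  + by rewrite -cats1 takel_cat ?size_s' // -size_s' take_size -Gx xi.
Qed.

Lemma prefix_chain (T : eqType) (s : nat -> seq T) :
  (forall k, prefix (s k) (s k.+1)) ->
  forall j k, (j <= k)%N -> prefix (s j) (s k).
Proof.
move=> s_pre j k /subnKC <-; elim: (k - j)%N => [|d IHd].
  by rewrite addn0 prefix_refl.
by rewrite addnS (prefix_trans IHd).
Qed.

Lemma chain_limit (T : eqType) (x0 : T) (s : nat -> seq T) :
  (forall k, prefix (s k) (s k.+1)) -> (forall k, (k <= size (s k))%N) ->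
  exists x : nat -> T,
    forall k t, (t <= size (s k))%N -> mkseq x t = take t (s k).
Proof.
move=> s_pre s_size; have s_le := prefix_chain _ _ s_pre.
have nth_le j k i : (j <= k)%N -> (i < size (s j))%N ->
    nth x0 (s k) i = nth x0 (s j) i.
  by move=> /s_le/prefixP[u ->] ij; rewrite nth_cat ij.
(* Stage [i.+1] is sure to be longer than [i], so the default [x0] is never read. *)
exists (fun i => nth x0 (s i.+1) i) => k t tk.
apply: (@eq_from_nth _ x0); first by rewrite size_mkseq size_takel.
move=> i; rewrite size_mkseq => it; rewrite nth_mkseq // nth_take //.
have [ik|ki] := leqP i.+1 k; first by rewrite (nth_le i.+1 k).
by rewrite (nth_le k i.+1) ?(leq_trans it) // ltnW.
Qed.

Lemma not_generatable_union :
  ~ generatable_in_limit (cofinitely_nonneg `|` all_neg).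
Proof.
case=> G G_gen.
have G_gen1 : generates_in_limit G cofinitely_nonneg.
  by move=> K K1; apply: G_gen; left.
(* Choice needs a total relation: a stage violating the invariant gets itself as a dummy
   successor. *)
have /choice[f fP] : forall kst : nat * (seq int * nat), exists st',
    stage_invariant kst.1 kst.2 -> stage_invariant kst.1.+1 st' /\ fools G kst.2 st'.
  move=> [k st]; have [inv|?] := pselect (stage_invariant k st).
    by have [st' ?] := fooling_step G k st G_gen1 inv; exists st'.
  by exists st.
pose st := fix st k := if k is k'.+1 then f (k', st k') else ([::], 0%N).
have st_cov k : stage_invariant k (st k).
  by elim: k => [|k /(fP (k, _))[]//]; split.
have st_fools k : fools G (st k) (st k.+1) by have [] := fP (k, st k) (st_cov k).
have st_pre k : prefix (st k).1 (st k.+1).1 by case: (st_fools k).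
have st_size k : (k <= size (st k).1)%N.
  elim: k => // k IHk.
  have [_ _ _ [t [m [/andP[le_t lt_t] _ _ _]]]] := st_fools k.
  by rewrite (leq_ltn_trans IHk) // (leq_ltn_trans le_t).
have [x xP] := chain_limit _ 0%R (fun k => (st k).1) st_pre st_size.
have x_take k : mkseq x (size (st k).1) = (st k).1 by rewrite (xP k) // take_size.
have x_mem i : x i \in (st i.+1).1.
  by rewrite -x_take map_f // mem_iota /= add0n st_size.
have x_inj : injective x.
  move=> i j xij; pose k := (maxn i j).+1.
  have [st_uniq _ _] := st_cov k; move: st_uniq; rewrite -x_take => /mkseq_uniqP.
  by apply=> //; rewrite inE (leq_trans _ (st_size k)) // ltnS ?leq_maxl ?leq_maxr.
have x_neg : all_neg (range x).
  move=> m; have [_ _ /(_ m)] := st_cov m.+1.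
  by rewrite ltnSn -x_take => /mapP[i _ ->]; exists i.
have [tstar Gx] := G_gen _ (or_intror x_neg) x (conj x_inj erefl).
(* This error occurs at a time [t] with [tstar <= size (st tstar).1 <= t], when [G] should already
   be correct. *)
have [_ _ _ [t [m [/andP[st_t t_st] m_lt m_notin Gt]]]] := st_fools tstar.
have [[i _ xi] _] := Gx t (leq_trans (st_size _) st_t).
move: xi; rewrite /output (xP tstar.+1) // Gt => xi.
have m_late d :
    Posz m \notin (st (tstar.+1 + d)).1 /\ (m < (st (tstar.+1 + d)).2)%N.
  elim: d => [|d [m_notin_d m_lt_d]]; first by rewrite addn0.
  have [_ le_n fresh _] := st_fools (tstar.+1 + d); rewrite addnS; split.
    by apply: contra m_notin_d; apply: fresh.
  exact: leq_trans le_n.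
(* Were [m] equal to [x i], it would be shown by stage [i.+1], hence by the later stage
   [tstar.+1 + i], which avoids it. *)
have [/negP[]] := m_late i; rewrite -xi.
have le_i : (i.+1 <= tstar.+1 + i)%N by lia.
have := prefix_chain _ (fun k => (st k).1) st_pre _ _ le_i.
by move=> /prefixW/mem_infix; apply; apply: x_mem.
Qed.

Theorem theorem1p1 :
  exists C1 C2 : set (set int),
    is_collection C1 /\ is_collection C2 /\
    nonuniformly_generatable_without_samples C1 /\
    uniformly_generatable_without_samples C2 /\
    ~ generatable_in_limit (C1 `|` C2).
Proof.
have Posz_inj : injective Posz by move=> i j [].
have Negz_inj : injective Negz by move=> i j [].
exists cofinitely_nonneg, all_neg; do ![split].
- by move=> K [n] /(infinite_set_inj_sub _ _ _ _ Posz_inj).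
- by move=> K K_neg; apply: (infinite_set_inj_sub _ _ _ 0 Negz_inj).
- by exists Posz; split.
- by exists Negz; split=> //; exists 0%N => K K_neg t _; apply: K_neg.
- exact: not_generatable_union.
Qed.
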